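(* Let $\mathsf C_{\mathcal H}$ be the coproduct in $\mathsf{AtoMon}$ of a family $\mathcal H=\{H_i\}_{i\in I}$ of atomic monoids indexed by a non-empty set $I$. Define a set $\Gamma_{\mathcal H}$ of non-empty words over the alphabet $I$ as follows: (1) if there exist $i,j\in I$ with $i\ne j$ such that $H_i^\times$ and $H_j^\times$ are both non-trivial, then $\Gamma_{\mathcal H}$ is the set of all non-empty $I$-words; (2) if there is a unique $i\in I$ such that $H_i^\times$ is non-trivial, then $\Gamma_{\mathcal H}$ is the set of all non-empty $I$-words without two consecutive letters both equal to $i$; (3) otherwise, $\Gamma_{\mathcal H}$ is the set of all non-empty $I$-words any two consecutive letters of which are different. Then $$\mathscr L^+(\mathsf C_{\mathcal H})=\bigcup_{i_1\ast\cdots\ast i_n\in\Gamma_{\mathcal H}}\{L_1+\cdots+L_n: L_1\in\mathscr L^+(H_{i_1}),\ldots,L_n\in\mathscr L^+(H_{i_n})\}.$$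
   Context: Monoids are not assumed commutative. For a monoid $H$, $H^\times$ is the group of units. An atom of $H$ is a non-unit $a\in H$ such that $a=xy$ with $x,y\in H$ implies $x\in H^\times$ or $y\in H^\times$; $\mathscr A(H)$ is the set of atoms. $H$ is atomic if every non-unit is a (non-empty, finite) product of atoms. $\mathsf{AtoMon}$ is the category whose objects are atomic monoids and whose morphisms are the monoid homomorphisms between atomic monoids sending atoms to atoms. The coproduct in $\mathsf{AtoMon}$ coincides with the coproduct (free product) $\mathsf C_{\mathcal H}$ of the $H_i$ in the category of monoids. For $x\in H$, the length set $\mathsf L_H(x)\subseteq\mathbb N$ is the set of all $k\in\mathbb N$ such that $x=a_1\cdots a_k$ for some $a_1,\ldots,a_k\in\mathscr A(H)$ (the empty product, $k=0$, being $1_H$). Set $\mathscr L(H):=\{\mathsf L_H(x): x\in H\}\setminus\{\emptyset\}$ and $\mathscr L^+(H):=\mathscr L(H)\setminus\{\{0\}\}$. For subsets of $\mathbb Z$, $X_1+\cdots+X_n:=\{x_1+\cdots+x_n: x_j\in X_j\}$. An $I$-word is a finite sequence $i_1\ast\cdots\ast i_n$ of elements of $I$ (an element of the free monoid $\mathscr F(I)$). *)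

(* Defs.v *)
From mathcomp Require Import all_boot.
From mathcomp Require Import boolp classical_sets.

Set Implicit Arguments.
Unset Strict Implicit.
Unset Printing Implicit Defensive.

Local Open Scope classical_set_scope.
Local Open Scope group_scope.

Section Monoids.
Variable H : monoidType.
Implicit Types x y a : H.

Definition units : set H := [set x | exists y, x * y = 1 /\ y * x = 1].

Definition nontrivial_units : Prop := exists2 u, units u & u <> 1.

Definition atoms : set H :=
  [set a | ~ units a /\ forall x y, a = x * y -> units x \/ units y].

(* For k = 0 the product is empty, i.e. equal to 1. *)
Definition length_set (x : H) : set nat :=
  [set k | exists2 a : 'I_k -> H, forall j, atoms (a j) & x = \prod_(j < k) a j].

Definition atomic : Prop :=
  forall x, ~ units x -> exists2 k, (0 < k)%N & length_set x k.

Definition system_of_lengths : set (set nat) := range length_set `\ set0.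

Definition system_of_lengths_pos : set (set nat) :=
  system_of_lengths `\ [set 0%N].

End Monoids.
Arguments units : clear implicits.
Arguments nontrivial_units : clear implicits.
Arguments atoms : clear implicits.
Arguments atomic : clear implicits.
Arguments system_of_lengths : clear implicits.
Arguments system_of_lengths_pos : clear implicits.

(* Morphisms of the category AtoMon of atomic monoids. *)
Definition atomon_morphism (H K : monoidType) (f : H -> K) : Prop :=
  monoid_morphism f /\ forall a, atoms H a -> atoms K (f a).

Definition is_atomon_coproduct (I : Type) (H : I -> monoidType)
    (C : monoidType) (inj : forall i, H i -> C) : Prop :=
  [/\ atomic C,
      forall i, atomon_morphism (inj i) &
      forall (K : monoidType) (f : forall i, H i -> K),
        atomic K -> (forall i, atomon_morphism (f i)) ->
        exists! g : C -> K,
          atomon_morphism g /\ forall i x, g (inj i x) = f i x].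

Definition consecutive (I : Type) (w : seq I) (j k : I) : Prop :=
  exists u v, w = u ++ j :: k :: v.

Definition Gamma (I : Type) (H : I -> monoidType) : set (seq I) :=
  let nt i := nontrivial_units (H i) in
  let two_nt := exists i j, [/\ i <> j, nt i & nt j] in
  [set w | w <> [::] /\
    [\/ two_nt,
        exists2 i, unique nt i & ~ consecutive w i i |
        [/\ ~ two_nt, ~ (exists! i, nt i) &
            forall j k, consecutive w j k -> j <> k]]].

Definition sumset (n : nat) (L : 'I_n -> set nat) : set nat :=
  [set (\sum_(j < n) x j)%N | x in [set x : 'I_n -> nat | forall j, L j (x j)]].

(* Main.v *)
Require Import Defs.
From HB Require Import structures.
From mathcomp Require Import all_boot.
From mathcomp Require Import boolp classical_sets.

Set Implicit Arguments.
Unset Strict Implicit.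
Unset Printing Implicit Defensive.

Local Open Scope classical_set_scope.
Local Open Scope group_scope.

(** The monoid coproduct of the [H i] can be described by reduced words: finite
    sequences of letters [x <> 1], each from one [H i], consecutive letters having
    different indices. So the length sets to be computed are those of reduced
    words.

    It is convenient to count the atoms in factorizations into atoms and units
    ([weak_lengths]). For a non-unit this gives the usual length set, since units
    can be absorbed by neighbouring atoms, and in an atomic monoid it gives [{0}]
    for a unit, since atomic monoids are Dedekind-finite ([units_of_mul1]). The
    central fact [free_weak_lengths] is that the weak length set of a reduced word
    [x_1 ... x_n] is the sum of those of its letters. The sum [free_lengths] is
    superadditive, because merging two letters can only create new
    factorizations; and this, together with the fact that length 0 characterizes
    units, gives all that is needed: the units, the atoms (an atom of some [H i]
    between two units, [free_atomP]) and the atomicity of the free product. As the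
    canonical maps and the maps induced on the free product preserve atoms, the
    free product is isomorphic to any coproduct in the category of atomic monoids
    ([coproduct_system_of_lengths]).

    Hence the length set of a non-unit reduced word is the sum of the length sets
    of its non-unit letters, and it remains to see which sequences of indices
    these letters can have. Two equal consecutive indices [j] can occur exactly
    when a non-trivial unit of some [H l], [l <> j], is available to separate the
    two letters, and the set [Gamma H] consists of the non-empty words in which
    every repetition is separable in this way ([GammaP]). *)

(** * Units, atoms and weak lengths in a monoid *)

Section WeakLengths.
Variable M : monoidType.
Implicit Types x y a u : M.

Lemma units1 : units M 1.
Proof. by exists 1; rewrite mulg1. Qed.

Lemma unitsM x y : units M x -> units M y -> units M (x * y).
Proof.
move=> [x' [xx' x'x]] [y' [yy' y'y]]; exists (y' * x'); split.
  by rewrite mulgA -(mulgA x) yy' mulg1.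
by rewrite mulgA -(mulgA y') x'x mulg1.
Qed.

Lemma atomsMl u a : units M u -> atoms M a -> atoms M (u * a).
Proof.
move=> [u' [uu' u'u]] [aN a_irr].
have u'U : units M u' by exists u.
have uU : units M u by exists u'.
have cancel_u z : u' * (u * z) = z by rewrite mulgA u'u mul1g.
split=> [uaU|x y uaxy].
  by apply: aN; rewrite -(cancel_u a); apply: unitsM.
have [|u'xU|yU] := a_irr (u' * x) y; last by right.
- by rewrite -mulgA -uaxy cancel_u.
- by left; rewrite -(mul1g x) -uu' -mulgA; apply: unitsM.
Qed.

Lemma atomsMr a u : atoms M a -> units M u -> atoms M (a * u).
Proof.
move=> [aN a_irr] [u' [uu' u'u]].
have u'U : units M u' by exists u.
have uU : units M u by exists u'.
have cancel_u z : z * u * u' = z by rewrite -mulgA uu' mulg1.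
split=> [auU|x y auxy].
  by apply: aN; rewrite -(cancel_u a); apply: unitsM.
have [|xU|yu'U] := a_irr x (y * u'); first by rewrite mulgA -auxy cancel_u.
- by left.
- by right; rewrite -(mulg1 y) -u'u mulgA; apply: unitsM.
Qed.

Lemma length_set0 x : length_set x 0 <-> x = 1.
Proof.
split=> [[a _ ->]|->]; first by rewrite big_ord0.
by exists (fun=> 1) => [[]|]; rewrite ?big_ord0.
Qed.

Lemma length_setS x k :
  length_set x k.+1 <->
  exists a y, [/\ atoms M a, length_set y k & x = a * y].
Proof.
split=> [[a a_at ->]|[a [y [a_at [b b_at ->] ->]]]].
  exists (a ord0), (\prod_(j < k) a (lift ord0 j)).
  by split; rewrite ?big_ord_recl //; exists (fun j => a (lift ord0 j)).
exists (fun j => oapp b a (unlift ord0 j)) => [j|].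
  by case: unliftP => [i _|_] /=.
rewrite big_ord_recl /= unlift_none; congr (_ * _).
by apply: eq_bigr => j _; rewrite liftK.
Qed.

Lemma length_setM x y k l :
  length_set x k -> length_set y l -> length_set (x * y) (k + l).
Proof.
elim: k x => [|k IHk] x; first by move=> /length_set0 -> yl; rewrite mul1g.
move=> /length_setS [a [z [a_at zk ->]]] yl.
by apply/length_setS; exists a, (z * y); rewrite mulgA; split=> //; apply: IHk.
Qed.

Lemma length_set_atom a : atoms M a -> length_set a 1%N.
Proof.
move=> a_at; apply/length_setS; exists a, 1.
by split; rewrite ?mulg1 //; apply/length_set0.
Qed.

Lemma length_setMunitl u x k :
  units M u -> (0 < k)%N -> length_set x k -> length_set (u * x) k.
Proof.
move=> uU; case: k => // k _ /length_setS [a [y [a_at yk ->]]].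
by apply/length_setS; exists (u * a), y; rewrite mulgA; split=> //; apply: atomsMl.
Qed.

Lemma length_setMunitr x u k :
  units M u -> (0 < k)%N -> length_set x k -> length_set (x * u) k.
Proof.
move=> uU; elim: k x => // k IHk x _ /length_setS [a [y [a_at yk ->]]].
case: k => [|k] in yk IHk *.
  move/length_set0: yk => ->; rewrite mulg1.
  by apply: length_set_atom; apply: atomsMr.
by apply/length_setS; exists a, (y * u); rewrite mulgA; split=> //; apply: IHk.
Qed.

(** Counting the atoms of a factorization into atoms and units. A unit other than
    1 has an empty length set, which would make the sum over the letters of a
    word empty; when unit factors are allowed it gets the length 0 instead. *)
Inductive weak_fact : M -> nat -> Prop :=
| weak_fact_unit u : units M u -> weak_fact u 0
| weak_fact_atom a : atoms M a -> weak_fact a 1%N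
| weak_factM x y k l :
    weak_fact x k -> weak_fact y l -> weak_fact (x * y) (k + l).

Definition weak_lengths x : set nat := [set k | weak_fact x k].

Lemma length_set_weak x : length_set x `<=` weak_lengths x.
Proof.
move=> k; elim: k x => [|k IHk] x.
  by move=> /length_set0 ->; apply: weak_fact_unit; apply: units1.
move=> /length_setS [a [y [a_at /IHk yk ->]]].
by rewrite -add1n; apply: weak_factM => //; apply: weak_fact_atom.
Qed.

(** As soon as one atom occurs, the unit factors can be absorbed into the atoms
    next to them, which leaves a genuine factorization of the same length. *)
Lemma weak_lengthsP x k : weak_lengths x k ->
  (units M x /\ k = 0%N) \/ ((0 < k)%N /\ length_set x k).
Proof.
elim=> {x k} [u uU|a a_at|x y k l _ IHx _ IHy]; first by left.
  by right; split=> //; apply: length_set_atom.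
case: IHx IHy => [[xU ->]|[k_gt0 xk]] [[yU ->]|[l_gt0 yl]].
- by left; split=> //; apply: unitsM.
- by right; split=> //; apply: length_setMunitl.
- by right; rewrite addn0; split=> //; apply: length_setMunitr.
- by right; rewrite addn_gt0 k_gt0; split=> //; apply: length_setM.
Qed.

Lemma weak_lengths0 x : weak_lengths x 0 <-> units M x.
Proof. by split=> [/weak_lengthsP[[]|[]]//|]; apply: weak_fact_unit. Qed.

Lemma weak_lengths_nonunit x : ~ units M x -> weak_lengths x = length_set x.
Proof.
move=> xN; apply/seteqP; split=> [k|]; last exact: length_set_weak.
by move=> /weak_lengthsP[[/xN]|[]].
Qed.

Hypothesis Matomic : atomic M.

(** Atomic monoids are Dedekind-finite. If [x * y = 1] with [x] not a unit, the
    first atom [a] of a factorization of [x] has a right inverse [b]; then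
    [a = a * (b * a)] forces [b * a] to be a unit, so [a] is also left
    invertible, hence a unit. *)
Lemma units_of_mul1 x y : x * y = 1 -> units M x.
Proof.
have atom_noninv a b : atoms M a -> a * b <> 1.
  move=> [aN a_irr] ab1.
  have [|//|baU] := a_irr a (b * a); first by rewrite mulgA ab1 mul1g.
  have [c [_ cba]] := baU; apply: aN; exists b; split=> //.
  have cb : c * b = b.
    by rewrite -(mulg1 (c * b)) -ab1 mulgA -(mulgA c b a) cba mul1g.
  by rewrite -cb -mulgA cba.
move=> xy1; apply: contrapT => xN.
have [[//|k] _ /length_setS [a [z [a_at _ xaz]]]] := Matomic xN.
by apply: (atom_noninv a (z * y) a_at); rewrite mulgA -xaz.
Qed.

Lemma units_mulP x y : units M (x * y) <-> units M x /\ units M y.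
Proof.
split=> [[z [xyz zxy]]|[]]; last exact: unitsM.
have xU : units M x by apply: (@units_of_mul1 _ (y * z)); rewrite mulgA.
have [x' [xx' x'x]] := xU; split=> //.
rewrite -(mul1g y) -x'x -mulgA; apply: unitsM; first by exists x.
by exists z.
Qed.

Lemma weak_lengths_unit u : units M u -> weak_lengths u = [set 0%N].
Proof.
move=> uU; apply/seteqP; split=> [k|_ ->]; last exact: weak_fact_unit.
move=> /weak_lengthsP[[]//|[]]; case: k => // k _ /length_setS.
by move=> [a [y [[aN _] _ uay]]]; case: aN; move: uU; rewrite uay => /units_mulP[].
Qed.

Lemma weak_lengths_atom a k : atoms M a -> weak_lengths a k -> k = 1%N.
Proof.
move=> [aN a_irr] /weak_lengthsP[[/aN]//|[]].
case: k => // k _ /length_setS [b [y [[bN _] yk ab]]].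
have [/bN//|yU] := a_irr _ _ ab.
by move/length_set_weak: yk; rewrite weak_lengths_unit// => ->.
Qed.

Lemma weak_lengths_neq0 x : exists k, weak_lengths x k.
Proof.
case: (pselect (units M x)) => [xU|xN]; first by exists 0%N; apply: weak_fact_unit.
by have [k _ xk] := Matomic xN; exists k; apply: length_set_weak.
Qed.

(** A unit has length set [set0] or [[set 0]], and these are exactly the two sets
    left out of the system. *)
Lemma system_of_lengths_posP (X : set nat) :
  system_of_lengths_pos M X <->
  exists2 x, ~ units M x & X = weak_lengths x.
Proof.
split=> [[[[x _ <-] x_neq0] x_neq1]|[x xN ->]].
  have xN : ~ units M x.
    move=> xU; apply: x_neq1; apply/seteqP.
    have sub0 : length_set x `<=` [set 0%N].
      by rewrite -(weak_lengths_unit xU); apply: length_set_weak.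
    split=> // _ ->; have /set0P[k xk] : length_set x != set0 by apply/eqP.
    by rewrite -(sub0 k xk).
  by exists x => //; rewrite weak_lengths_nonunit.
split; last first.
  move=> x0; apply: xN; apply/weak_lengths0.
  by rewrite x0.
split=> [|x0]; first by exists x; rewrite // weak_lengths_nonunit.
by have [k] := weak_lengths_neq0 x; rewrite x0.
Qed.

End WeakLengths.

(** * Length sets under morphisms *)

Section Morphisms.
Variables (M N : monoidType).

Lemma units_morph (f : M -> N) x :
  monoid_morphism f -> units M x -> units N (f x).
Proof.
by move=> [f1 fM] [y [xy yx]]; exists (f y); rewrite -!fM xy yx f1.
Qed.

Lemma length_set_morph (f : M -> N) x :
  atomon_morphism f -> length_set x `<=` length_set (f x).
Proof.
move=> [[f1 fM] f_at] k; elim: k x => [|k IHk] x.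
  by move=> /length_set0 ->; apply/length_set0.
move=> /length_setS [a [y [a_at yk ->]]].
by apply/length_setS; exists (f a), (f y); split; [exact: f_at|exact: IHk|].
Qed.

Lemma weak_lengths_morph (f : M -> N) x :
  atomon_morphism f -> weak_lengths x `<=` weak_lengths (f x).
Proof.
move=> [fmor f_at] k; elim=> {x k} [u uU|a a_at|x y k l _ IHx _ IHy].
- exact/weak_fact_unit/units_morph.
- exact/weak_fact_atom/f_at.
- by rewrite fmor.2; apply: weak_factM.
Qed.

End Morphisms.

Lemma system_of_lengths_pos_iso (M N : monoidType) (f : M -> N) (g : N -> M) :
  atomon_morphism f -> atomon_morphism g -> cancel f g -> cancel g f ->
  system_of_lengths_pos M = system_of_lengths_pos N.
Proof.
have sub (P Q : monoidType) (p : P -> Q) (q : Q -> P) :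
    atomon_morphism p -> atomon_morphism q -> cancel p q ->
    system_of_lengths_pos P `<=` system_of_lengths_pos Q.
  move=> pmor qmor pK X [[[x _ <-] ?] ?]; split=> //; split=> //.
  exists (p x) => //; apply/seteqP; split=> [k|]; last exact: length_set_morph.
  by move=> /(length_set_morph qmor); rewrite pK.
by move=> fmor gmor fK gK; apply/seteqP; split; [apply: sub fK|apply: sub gK].
Qed.

(** * The free product as a monoid of reduced words *)

Section FreeProduct.
Variables (I : Type) (H : I -> monoidType).

Definition letter : Type := {i : I & H i}.

Definition off (i : I) (s : seq letter) : Prop :=
  if s is p :: _ then tag p <> i else True.

Fixpoint reduced (s : seq letter) : Prop :=
  if s is p :: s' then [/\ tagged p <> 1, off (tag p) s' & reduced s'] else True.

(** The first factor of [s] in [H i], taken to be 1 when [s] does not start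
    with a letter of [H i], together with the rest of [s]. *)
Definition split_at (i : I) (s : seq letter) : H i * seq letter :=
  if s is existT j y :: s' then
    if pselect (j = i) is left ji then (eq_rect j (fun l => H l : Type) y i ji, s')
    else (1, s)
  else (1, s).

Definition join_at (i : I) (x : H i) (s : seq letter) : seq letter :=
  if x == 1 then s else existT (fun l => H l : Type) i x :: s.

(** [split_at i] and [join_at] are inverse to each other between the reduced
    words and the pairs [(x, s)] with [x : H i] and [s] reduced and not starting
    with a letter of [H i]; the possibility [x = 1] is what makes this uniform,
    and everything about the action of [H i] follows from it. *)
Lemma split_at_reduced i s : reduced s ->
  [/\ join_at (split_at i s).1 (split_at i s).2 = s,
      off i (split_at i s).2 & reduced (split_at i s).2].
Proof.
case: s => [|[j y] s] /=; first by rewrite /join_at eqxx.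
move=> [/= /eqP y1 sj s_red]; case: pselect => [ji|nji] /=.
  by case: i / ji; rewrite /= /join_at (negPf y1).
by rewrite /join_at eqxx; split=> //; split=> //; apply/eqP.
Qed.

Lemma join_atK i (x : H i) s : off i s -> split_at i (join_at x s) = (x, s).
Proof.
rewrite /join_at; case: eqP => [->|_] si.
  by case: s si => [|[j y] s] //= ji; case: pselect.
by rewrite /=; case: pselect => // ii; rewrite (Prop_irrelevance ii erefl).
Qed.

Lemma join_at_reduced i (x : H i) s :
  off i s -> reduced s -> reduced (join_at x s).
Proof. by rewrite /join_at; case: eqP. Qed.

(** Left multiplication by an element of [H i]. *)
Definition act (i : I) (x : H i) (s : seq letter) : seq letter :=
  join_at (x * (split_at i s).1) (split_at i s).2.

Lemma act_reduced i (x : H i) s : reduced s -> reduced (act x s).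
Proof. by case/(split_at_reduced i) => _ ? ?; apply: join_at_reduced. Qed.

Lemma act1 i s : reduced s -> act (1 : H i) s = s.
Proof. by case/(split_at_reduced i) => + _ _; rewrite /act mul1g. Qed.

Lemma actM i (x y : H i) s : reduced s -> act (x * y) s = act x (act y s).
Proof.
by case/(split_at_reduced i) => _ si _; rewrite /act join_atK //= mulgA.
Qed.

Lemma act_off i (x : H i) s : off i s -> act x s = join_at x s.
Proof.
move=> si; have := join_atK (1 : H i) si; rewrite /join_at eqxx.
by rewrite /act => -> /=; rewrite mulg1.
Qed.

(** The product of reduced words is the action of the letters of the left word,
    one by one, on the right word (van der Waerden's trick): associativity then
    reduces to each [H i] acting, and no case analysis on cancellations in the
    middle of a product is ever needed. *)
Definition cat_reduced (s t : seq letter) : seq letter :=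
  foldr (fun p => act (tagged p)) t s.

Lemma cat_reduced_reduced s t : reduced t -> reduced (cat_reduced s t).
Proof. by move=> t_red; elim: s => //= p s; apply: act_reduced. Qed.

Lemma cat_reduced_join i (x : H i) s t : reduced t ->
  cat_reduced (join_at x s) t = act x (cat_reduced s t).
Proof.
move=> t_red; rewrite /join_at; case: eqP => [->|//].
by rewrite act1 //; apply: cat_reduced_reduced.
Qed.

Lemma cat_reduced_act i (x : H i) s t : reduced s -> reduced t ->
  cat_reduced (act x s) t = act x (cat_reduced s t).
Proof.
move=> s_red t_red; have [sE _ _] := split_at_reduced i s_red.
rewrite -[in RHS]sE /act !cat_reduced_join //.
by rewrite actM //; apply: cat_reduced_reduced.
Qed.

Lemma cat_reducedA s t r : reduced t -> reduced r ->
  cat_reduced s (cat_reduced t r) = cat_reduced (cat_reduced s t) r.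
Proof.
move=> t_red r_red; elim: s => //= p s ->.
by rewrite cat_reduced_act //; apply: cat_reduced_reduced.
Qed.

Lemma cat_reduceds0 s : reduced s -> cat_reduced s [::] = s.
Proof.
elim: s => //= -[i x] s IHs [/= /eqP xN si s_red].
by rewrite IHs // act_off // /join_at (negPf xN).
Qed.

Definition free_product : Type := {s : seq letter | reduced s}.

Lemma free_product_eq (r s : free_product) : sval r = sval s -> r = s.
Proof. by case: r s => [r ?] [s ?] /= rs; apply: eq_exist. Qed.

HB.instance Definition _ := gen_eqMixin free_product.
HB.instance Definition _ := gen_choiceMixin free_product.

Definition free_mul (r s : free_product) : free_product :=
  exist _ (cat_reduced (sval r) (sval s)) (cat_reduced_reduced _ (svalP s)).

Definition free_one : free_product := exist _ [::] Logic.I.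

Fact free_mulA : associative free_mul.
Proof.
move=> r s t; apply: free_product_eq; apply: cat_reducedA.
- exact: (svalP s).
- exact: (svalP t).
Qed.

Fact free_mul1 : left_id free_one free_mul.
Proof. by move=> [s s_red]; apply: eq_exist. Qed.

Fact free_mulr1 : right_id free_one free_mul.
Proof. by move=> [s s_red]; apply: free_product_eq; apply: cat_reduceds0. Qed.

HB.instance Definition _ :=
  isMonoid.Build free_product free_mulA free_mul1 free_mulr1.

Definition free_inj (i : I) (x : H i) : free_product :=
  exist _ (act x [::]) (act_reduced x (Logic.I : reduced [::])).

Lemma free_inj_mulE i (x : H i) (r : free_product) :
  sval (free_inj x * r) = act x (sval r).
Proof. by rewrite [LHS]cat_reduced_act //; apply: (svalP r). Qed.

Lemma free_inj1 i : free_inj (1 : H i) = 1.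
Proof. by apply: free_product_eq; exact: act1. Qed.

Lemma free_injM i (x y : H i) : free_inj (x * y) = free_inj x * free_inj y.
Proof. by apply: free_product_eq; rewrite free_inj_mulE; exact: actM. Qed.

Lemma free_inj_morphism i : monoid_morphism (@free_inj i).
Proof. by split; [exact: free_inj1|exact: free_injM]. Qed.

Lemma free_inj_off i (x : H i) (r : free_product) : off i (sval r) ->
  sval (free_inj x * r) = join_at x (sval r).
Proof. by rewrite free_inj_mulE; apply: act_off. Qed.

(** Hides the encoding: reduced words are built by multiplying on the left with
    non-trivial elements that do not merge with the first letter. *)
Lemma free_ind (P : free_product -> Prop) : P 1 ->
    (forall i (x : H i) (r : free_product),
      x <> 1 -> off i (sval r) -> P r -> P (free_inj x * r)) ->
  forall r, P r.
Proof.
move=> P1 PM [s]; elim: s => [|[i x] s IHs] s_red.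
  by rewrite (_ : exist _ _ _ = (1 : free_product)) //; apply: eq_exist.
have [/= xN si s_red'] := s_red.
set r : free_product := exist _ s s_red'.
rewrite (_ : exist _ _ _ = free_inj x * r); first by apply: PM => //; apply: IHs.
by apply: free_product_eq; rewrite [RHS]free_inj_off // /join_at; case: eqP.
Qed.

Lemma free_gen_ind (P : free_product -> Prop) : P 1 ->
    (forall i (x : H i) r, P r -> P (free_inj x * r)) ->
  forall r, P r.
Proof. by move=> P1 PM; apply: free_ind => // i x r _ _; apply: PM. Qed.

Lemma free_split i (r : free_product) : exists (y : H i) (t : free_product),
  off i (sval t) /\ r = free_inj y * t.
Proof.
have [rE ri r_red] := split_at_reduced i (svalP r).
exists (split_at i (sval r)).1, (exist _ _ r_red); split=> //.
by apply: free_product_eq; rewrite free_inj_off.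
Qed.

Section Lift.
Variables (K : monoidType) (f : forall i, H i -> K).
Hypothesis f_mor : forall i, monoid_morphism (@f i).

Definition free_lift (r : free_product) : K :=
  foldr (fun p y => f (tagged p) * y) 1 (sval r).

Lemma free_lift_off i (x : H i) r : off i (sval r) ->
  free_lift (free_inj x * r) = f x * free_lift r.
Proof.
move=> ri; rewrite /free_lift free_inj_off // /join_at.
by case: eqP => // ->; rewrite (f_mor _).1 mul1g.
Qed.

Lemma free_lift_mul_inj i (x : H i) r :
  free_lift (free_inj x * r) = f x * free_lift r.
Proof.
have [y [t [ti ->]]] := free_split i r.
by rewrite mulgA -free_injM !free_lift_off // (f_mor _).2 mulgA.
Qed.

Lemma free_lift_inj i (x : H i) : free_lift (free_inj x) = f x.
Proof. by rewrite -[free_inj x]mulg1 free_lift_mul_inj [free_lift 1]/= mulg1. Qed.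

Lemma free_lift_morphism : monoid_morphism free_lift.
Proof.
split=> // r s; elim/free_gen_ind: r => [|i x r IHr].
  by rewrite mul1g [free_lift 1]/= mul1g.
by rewrite -mulgA !free_lift_mul_inj IHr mulgA.
Qed.

End Lift.
End FreeProduct.

(** * Length sets in a free product of atomic monoids *)

Definition msum (A B : set nat) : set nat :=
  [set (a + b)%N | a in A & b in B].

Lemma msum0n A : msum [set 0%N] A = A.
Proof.
apply/seteqP; split=> [_ [_ -> [a Aa <-]]//|a Aa].
by exists 0%N => //; exists a.
Qed.

Lemma msumn0 A : msum A [set 0%N] = A.
Proof.
apply/seteqP; split=> [_ [a Aa [_ -> <-]]|a Aa]; first by rewrite addn0.
by exists a => //; exists 0%N; rewrite ?addn0.
Qed.

Section FreeLengths.
Variables (I : Type) (H : I -> monoidType).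
Hypothesis Hatomic : forall i, atomic (H i).
Local Notation F := (free_product H).
Implicit Types r s : F.

(** The weak length set of [r], as [free_weak_lengths] will show. *)
Definition free_lengths r : set nat :=
  foldr (fun (p : letter H) A =>
    msum (@weak_lengths (H (tag p)) (tagged p)) A) [set 0%N] (sval r).

(** This also covers [x = 1], where the letter disappears, because 1 has the
    single weak length 0. *)
Lemma free_lengths_off i (x : H i) r : off i (sval r) ->
  free_lengths (free_inj x * r) = msum (weak_lengths x) (free_lengths r).
Proof.
move=> ri; rewrite /free_lengths free_inj_off // /join_at.
case: eqP => // ->; rewrite weak_lengths_unit ?msum0n //; exact: units1.
Qed.

Lemma free_lengths_inj i (x : H i) : free_lengths (free_inj x) = weak_lengths x.
Proof. by rewrite -[free_inj x]mulg1 free_lengths_off // msumn0. Qed.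

(** Two letters that merge only gain weak lengths, by [weak_factM]. *)
Lemma free_lengthsM r s k l :
  free_lengths r k -> free_lengths s l -> free_lengths (r * s) (k + l).
Proof.
move=> + sl; elim/free_ind: r k => [|i x r _ ri IHr] k.
  by rewrite mul1g => ->.
rewrite free_lengths_off // => -[a xa [b rb <-]].
rewrite -mulgA -addnA; move: (IHr _ rb).
have [y [t [ti ->]]] := free_split i (r * s).
rewrite mulgA -free_injM !free_lengths_off // => -[c yc [d td <-]].
rewrite addnA; exists (a + c)%N; first exact: weak_factM.
by exists d.
Qed.

(** The length 0 detects units, so for it the superadditivity becomes an
    equivalence: in an atomic monoid a product is a unit only if its factors
    are. *)
Lemma free_lengths0_inj_mul i (x : H i) r :
  free_lengths (free_inj x * r) 0 <-> units (H i) x /\ free_lengths r 0.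
Proof.
have [y [t [ti ->]]] := free_split i r.
rewrite mulgA -free_injM !free_lengths_off //.
have msum00 A B : msum A B 0 <-> A 0%N /\ B 0%N.
  split=> [[a Aa [b Bb /eqP]]|[A0 B0]]; last by exists 0%N => //; exists 0%N.
  by rewrite addn_eq0 => /andP[/eqP a0 /eqP b0]; move: Aa Bb; rewrite a0 b0.
rewrite !msum00 !weak_lengths0 (units_mulP (@Hatomic i)); tauto.
Qed.

Lemma free_lengths0_mul r s :
  free_lengths (r * s) 0 <-> free_lengths r 0 /\ free_lengths s 0.
Proof.
elim/free_gen_ind: r => [|i x r IHr]; first by rewrite mul1g; split=> [|[]].
by rewrite -mulgA !free_lengths0_inj_mul IHr; tauto.
Qed.

Lemma free_unitsP r : units F r <-> free_lengths r 0.
Proof.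
split=> [[s [rs1 _]]|].
  have: free_lengths (r * s) 0 by rewrite rs1.
  by case/free_lengths0_mul.
elim/free_gen_ind: r => [|i x r IHr]; first by move=> _; apply: units1.
case/free_lengths0_inj_mul => xU /IHr rU; apply: unitsM => //.
exact: units_morph (free_inj_morphism H i) xU.
Qed.

Lemma free_units_inj i (x : H i) : units F (free_inj x) <-> units (H i) x.
Proof. by rewrite free_unitsP free_lengths_inj weak_lengths0. Qed.

Lemma free_units_inj_mul i (x : H i) r :
  units F (free_inj x * r) <-> units (H i) x /\ units F r.
Proof. by rewrite !free_unitsP free_lengths0_inj_mul. Qed.

Lemma free_lengths_neq0 r : exists k, free_lengths r k.
Proof.
elim/free_ind: r => [|i x r _ ri [l rl]]; first by exists 0%N.
have [k xk] := weak_lengths_neq0 (@Hatomic i) x.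
by exists (k + l)%N; rewrite free_lengths_off //; exists k => //; exists l.
Qed.

(** If [free_inj a = r * s], then any lengths [k] of [r] and [l] of [s] satisfy
    [k + l = 1] by superadditivity; so one of them is 0, and that factor is a
    unit. *)
Lemma free_inj_atom i (a : H i) : atoms (H i) a -> atoms F (free_inj a).
Proof.
move=> a_at; split=> [/free_units_inj|r s ars]; first by case: a_at => aN _ /aN.
have [k rk] := free_lengths_neq0 r; have [l sl] := free_lengths_neq0 s.
have : free_lengths (free_inj a) (k + l) by rewrite ars; apply: free_lengthsM.
rewrite free_lengths_inj => /(weak_lengths_atom (@Hatomic i) a_at).
rewrite !free_unitsP; case: k rk => [|k] rk; first by left.
by case: l sl => [|l] sl; [right | rewrite addSnnS !addnS].
Qed.

Lemma free_inj_atomon i : atomon_morphism (@free_inj I H i).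
Proof. by split; [exact: free_inj_morphism|exact: free_inj_atom]. Qed.

(** The first letter of an atom is either a unit, to be moved into [u], or the
    atom of [H i], the remaining word being then the unit [v]. *)
Lemma free_atomP A : atoms F A ->
  exists u i (a : H i) v,
    [/\ units F u, atoms (H i) a, units F v & A = u * (free_inj a * v)].
Proof.
elim/free_gen_ind: A => [[/(_ (units1 _))//]|i x r IHr xr_at].
have [xrN xr_irr] := xr_at.
have [xU|rU] := xr_irr _ _ erefl.
  have [x' [xx' x'x]] := xU.
  have [|u [j [a [v [uU a_at vU rE]]]]] := IHr.
    rewrite -[r]mul1g -x'x -mulgA; apply: atomsMl => //.
    by exists (free_inj x).
  exists (free_inj x * u), j, a, v; split=> //; first exact: unitsM.
  by rewrite -mulgA rE.
exists 1, i, x, r; split=> //; [exact: units1| |by rewrite mul1g].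
split=> [xU|y z xyz]; first by apply: xrN; apply/free_units_inj_mul.
have [|/free_units_inj|] := xr_irr (free_inj y) (free_inj z * r).
- by rewrite mulgA -free_injM xyz.
- by left.
- by case/free_units_inj_mul; right.
Qed.

(** For the inclusion from left to right, superadditivity leaves only the units
    and the atoms of the free product to look at, and these are known from
    [free_unitsP] and [free_atomP]. In the other direction a factorization of
    each letter is carried over by [free_inj]. *)
Lemma free_weak_lengths r : weak_lengths r = free_lengths r.
Proof.
apply/seteqP; split=> k.
  elim=> {r k} [u /free_unitsP//|A|r s k l _ rk _ sl]; last exact: free_lengthsM.
  move=> /free_atomP[u [i [a [v [uU a_at vU ->]]]]].
  apply: (@free_lengthsM _ _ 0 1); first exact/free_unitsP.
  apply: (@free_lengthsM _ _ 1 0); last exact/free_unitsP.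
  by rewrite free_lengths_inj; apply: weak_fact_atom.
elim/free_ind: r k => [|i x r _ ri IHr] k.
  by move=> ->; apply/weak_fact_unit/units1.
rewrite free_lengths_off // => -[a xa [b /IHr rb <-]].
by apply: weak_factM => //; apply: (weak_lengths_morph (free_inj_atomon i)).
Qed.

Lemma free_atomic : atomic F.
Proof.
move=> r rN; have [k] := free_lengths_neq0 r.
by rewrite -free_weak_lengths => /weak_lengthsP[[/rN]//|[]]; exists k.
Qed.

Lemma free_lift_atomon (K : monoidType) (f : forall i, H i -> K) :
  (forall i, atomon_morphism (@f i)) -> atomon_morphism (free_lift f).
Proof.
move=> f_mor; have f_mor1 i := (f_mor i).1.
have lift_mor := free_lift_morphism f_mor1; split=> // A.
move=> /free_atomP[u [i [a [v [uU a_at vU ->]]]]].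
rewrite lift_mor.2 free_lift_mul_inj //.
apply: atomsMl; first exact: units_morph uU.
by apply: atomsMr; [apply: (f_mor i).2|apply: units_morph vU].
Qed.

End FreeLengths.

(** * Comparing the coproduct with the free product *)

Section Coproduct.
Variables (I : Type) (H : I -> monoidType) (C : monoidType).
Variable inj : forall i : I, H i -> C.
Hypothesis Hatomic : forall i, atomic (H i).

(** The universal property of [C] gives [g : C -> F]. In the other direction
    [free_lift inj] is a monoid morphism, and it sends atoms to atoms because an
    atom of [F] is a [free_inj a] between two units; so the uniqueness part
    applies to its composite with [g]. *)
Lemma coproduct_system_of_lengths : is_atomon_coproduct inj ->
  system_of_lengths_pos C = system_of_lengths_pos (free_product H).
Proof.
move=> [Catomic inj_mor univ].
have [g [[g_mor g_inj] _]] :=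
  univ _ _ (free_atomic Hatomic) (free_inj_atomon Hatomic).
have inj_mor1 i := (inj_mor i).1.
have lift_mor := free_lift_atomon Hatomic inj_mor.
apply: (system_of_lengths_pos_iso g_mor lift_mor) => [c|].
  (* Both [free_lift inj \o g] and the identity of [C] extend [inj]. *)
  have [h [_ h_uniq]] := univ _ _ Catomic inj_mor.
  rewrite -[LHS]/((free_lift inj \o g) c) -(h_uniq (free_lift inj \o g)).
    rewrite -{2}[c]/(idfun c) -(h_uniq idfun) //; split=> //; split=> //.
  split=> [|i x]; last by rewrite /= g_inj free_lift_inj.
  split=> [|a a_at]; last exact/lift_mor.2/g_mor.2.
  by split=> [|x y]; rewrite /= ?g_mor.1.1 ?g_mor.1.2 ?lift_mor.1.1 ?lift_mor.1.2.
elim/free_gen_ind => [|i x r IHr].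
  by rewrite lift_mor.1.1 g_mor.1.1.
by rewrite free_lift_mul_inj // g_mor.1.2 g_inj IHr.
Qed.

End Coproduct.

(** * Sumsets along a word, and the words allowed *)

Lemma sumset_recl n (L : 'I_n.+1 -> set nat) :
  sumset L = msum (L ord0) (sumset (fun j => L (lift ord0 j))).
Proof.
apply/seteqP; split=> [_ [x xL <-]|_ [a aL [_ [x xL <-] <-]]].
  exists (x ord0) => //; rewrite big_ord_recl.
  by exists (\sum_(j < n) x (lift ord0 j))%N => //; exists (fun j => x (lift ord0 j)).
exists (fun j => oapp x a (unlift ord0 j)) => [j|].
  by case: unliftP => [i ->|->] /=.
rewrite big_ord_recl unlift_none; congr (_ + _)%N.
by apply: eq_bigr => j _; rewrite liftK.
Qed.

Section Words.
Variables (I : Type) (H : I -> monoidType).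

(** The recursion on the word avoids functions on [ordinal (size w)] whose values
    are constrained by the dependent type [H (tnth _ j)]. *)
Fixpoint word_sums (w : seq I) : set (set nat) :=
  if w is i :: w' then
    [set msum A B | A in system_of_lengths_pos (H i) & B in word_sums w']
  else [set [set 0%N]].

Lemma word_sumsE w : word_sums w =
  [set sumset L | L in [set L : 'I_(size w) -> set nat |
     forall j, system_of_lengths_pos (H (tnth (in_tuple w) j)) (L j)]].
Proof.
elim: w => [|i w IHw].
  have sumset0 (L : 'I_0 -> set nat) : sumset L = [set 0%N].
    apply/seteqP; split=> [_ [x _ <-]|_ ->]; first by rewrite big_ord0.
    by exists (fun=> 0%N) => [[]|]; rewrite ?big_ord0.
  apply/seteqP; split=> [_ ->|_ [L _ <-]]; last exact: sumset0.
  by exists (fun=> set0) => [[]|]; last exact: sumset0.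
have tnth_lift j : tnth (in_tuple (i :: w)) (lift ord0 j) = tnth (in_tuple w) j.
  by rewrite !(tnth_nth i).
rewrite /= IHw; apply/seteqP; split=> [_ [A Ai [_ [L Lw <-] <-]]|_ [L Lw <-]].
  exists (fun j => oapp L A (unlift ord0 j)) => [j|].
    by case: unliftP => [k ->|->] //=; rewrite tnth_lift; apply: Lw.
  rewrite sumset_recl unlift_none; congr (msum _ (sumset _)).
  by apply/funext => j; rewrite liftK.
rewrite sumset_recl; exists (L ord0); first exact: (Lw ord0).
exists (sumset (fun j => L (lift ord0 j))) => //.
by exists (fun j => L (lift ord0 j)) => // j; rewrite -tnth_lift; apply: Lw.
Qed.

Lemma consecutive_cons2 i k w (j l : I) :
  consecutive (i :: k :: w) j l <-> (i = j /\ k = l) \/ consecutive (k :: w) j l.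
Proof.
split=> [[[|i' u] [v]] [-> e]|[[-> ->]|[u [v ->]]]].
- by left.
- by right; exists u, v.
- by exists [::], w.
- by exists (i :: u), v.
Qed.

Lemma sorted_consecutive (e : rel I) w :
  sorted e w <-> forall j k, consecutive w j k -> e j k.
Proof.
elim: w => [|i [|k w] IHw]; first by split=> // _ j k [[|? ?] [?]].
  by split=> // _ j k [[|? [|? ?]] [?]].
rewrite [sorted _ _]/=; split=> [/andP[ik /IHw kw] j l|kw].
  by case/consecutive_cons2 => [[<- <-]|/kw].
apply/andP; split; first by apply/kw/consecutive_cons2; left.
by apply/IHw => j l jl; apply/kw/consecutive_cons2; right.
Qed.

(** Equal consecutive letters are allowed when a non-trivial unit of another
    monoid can be put between them. *)
Definition separable (j k : I) : bool :=
  `[< j = k -> exists2 l, l <> j & nontrivial_units (H l) >].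

(** The three cases defining [Gamma] are one condition. With two indices having
    non-trivial units, one of them differs from any given [j]; with a unique
    such index [i], only [i] cannot be repeated; with none, no index can. *)
Lemma GammaP w : Gamma H w <-> w <> [::] /\ sorted separable w.
Proof.
have w_sep : sorted separable w <->
    forall j, consecutive w j j -> exists2 l, l <> j & nontrivial_units (H l).
  rewrite sorted_consecutive; split=> [sep j /sep/asboolP|sep j k jk]; first exact.
  by apply/asboolP => ejk; apply: sep; rewrite {2}ejk.
rewrite w_sep; split=> -[wN0 cond]; split=> //.
  move=> j jj; case: cond => [[i [k [ik iU kU]]]|[i [iU _] ii]|[_ _ /(_ _ _ jj)//]].
    case: (pselect (i = j)) => [ij|ij]; last by exists i.
    by exists k => //; rewrite -ij; apply: nesym.
  by exists i => // ij; apply: ii; rewrite ij.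
have [two|ntwo] := pselect (exists i j,
    [/\ i <> j, nontrivial_units (H i) & nontrivial_units (H j)]).
  exact: Or31.
have [[i iU]|nuniq] := pselect (exists! i, nontrivial_units (H i)).
  apply: Or32; exists i => // /cond [l li lU]; apply: ntwo; exists l, i.
  by split=> //; apply: iU.1.
apply: Or33; split=> // j k jk ejk; apply: nuniq.
have [|l lj lU] := cond j; first by rewrite {2}ejk.
exists l; split=> // l' l'U; apply: contrapT => ll'.
by apply: ntwo; exists l, l'.
Qed.

End Words.

(** * The words occurring in the free product *)

Section LengthsOfWords.
Variables (I : Type) (H : I -> monoidType).
Hypothesis Hatomic : forall i, atomic (H i).
Local Notation F := (free_product H).

Definition nonunit_letter (p : letter H) : bool :=
  `[< ~ units (H (tag p)) (tagged p) >].

Definition nonunit_indices (r : F) : seq I :=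
  [seq tag p | p <- sval r & nonunit_letter p].

Lemma free_lengths_word_sums r :
  word_sums H (nonunit_indices r) (free_lengths r).
Proof.
rewrite /nonunit_indices /free_lengths.
elim: (sval r) => //= -[i x] s IHs /=.
case: ifP => [/asboolP xN|/asboolP/contrapT xU]; last first.
  by rewrite weak_lengths_unit // msum0n.
exists (weak_lengths x); first by apply/system_of_lengths_posP => //; exists x.
by exists (foldr (fun (p : letter H) A =>
  msum (@weak_lengths (H (tag p)) (tagged p)) A) [set 0%N] s).
Qed.

(** Between two non-unit letters with the same index that become neighbours, the
    reduced word has a letter with another index, which is then a non-trivial
    unit. *)
Lemma nonunit_indices_sorted r : sorted (separable H) (nonunit_indices r).
Proof.
rewrite /nonunit_indices.
(* Here [i] is the index of the last non-unit letter met and [j] that of the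
   last letter met. *)
have pathP s i j : off j s -> reduced s ->
    i = j \/ (exists2 l, l <> i & nontrivial_units (H l)) ->
    path (separable H) i [seq tag p | p <- s & nonunit_letter p].
  elim: s i j => //= -[k x] s IHs i j /= kj [xN1 sk s_red] ij.
  case: ifP => [_|/asboolP/contrapT xU] /=.
    apply/andP; split; last by apply: (IHs k k) => //; left.
    by apply/asboolP => ik; case: ij => // ij; case: kj; rewrite -ik.
  apply: (IHs i k) => //; have [->|ik] := pselect (i = k); first by left.
  by right; exists k; [exact: nesym|exists x].
case: r => s /=; elim: s => //= -[k x] s IHs [_ sk s_red] /=.
case: ifP => _; last exact: IHs.
by apply: (pathP s k k) => //; left.
Qed.

Lemma nonunit_indices_nil r : nonunit_indices r = [::] -> units F r.
Proof.
move=> r_nil; apply/(free_unitsP Hatomic); move: r_nil.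
have := free_lengths_word_sums r; case: nonunit_indices => //= ->.
by [].
Qed.

(** Two equal consecutive indices are realized by putting a non-trivial unit of
    another monoid between the two letters, which keeps the word reduced and does
    not change the lengths. The non-unit [x] in front is what the induction
    needs to know about the first letter. *)
Lemma word_sums_free i w X :
  path (separable H) i w -> word_sums H (i :: w) X ->
  exists (x : H i) (r : F),
    [/\ ~ units (H i) x, off i (sval r) & X = free_lengths (free_inj x * r)].
Proof.
elim: w i X => [|k w IHw] i X.
  move=> _ [_ /(system_of_lengths_posP (@Hatomic i))[x xN ->] [_ -> <-]].
  by exists x, 1; split=> //; rewrite free_lengths_off.
move=> /= /andP[/asboolP ik kw].
move=> [_ /(system_of_lengths_posP (@Hatomic i))[x xN ->] [B /(IHw _ _ kw)]].
move=> [y [r [yN rk BE]]] <-; exists x.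
have y1 : y <> 1 by move=> y1; apply: yN; rewrite y1; apply: units1.
have headE : sval (free_inj y * r) = existT (fun l => H l : Type) k y :: sval r.
  by rewrite free_inj_off // /join_at; case: eqP.
have [eik|nik] := pselect (i = k); last first.
  have offi : off i (sval (free_inj y * r)) by rewrite headE; apply: nesym.
  by exists (free_inj y * r); split=> //; rewrite free_lengths_off // -BE.
have [l li [u uU u1]] := ik eik.
have offl : off l (sval (free_inj y * r)) by rewrite headE /= -eik; apply: nesym.
have offi : off i (sval (free_inj u * (free_inj y * r))).
  by rewrite free_inj_off // /join_at; case: eqP.
exists (free_inj u * (free_inj y * r)); split=> //.
by rewrite 2?free_lengths_off // (weak_lengths_unit (@Hatomic l) uU) msum0n BE.
Qed.

Lemma free_system_of_lengths :
  system_of_lengths_pos F = \bigcup_(w in Gamma H) word_sums H w.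
Proof.
have FP := system_of_lengths_posP (free_atomic Hatomic).
apply/seteqP; split=> [X /FP[r rN ->]|X [w /GammaP[+ w_sorted] wX]].
  exists (nonunit_indices r).
    apply/GammaP; split; last exact: nonunit_indices_sorted.
    by move=> /nonunit_indices_nil.
  by rewrite free_weak_lengths //; apply: free_lengths_word_sums.
case: w w_sorted wX => // i w w_path wX _.
have [x [r [xN _ ->]]] := word_sums_free w_path wX.
apply/FP; exists (free_inj x * r); last by rewrite free_weak_lengths.
by move=> /(free_units_inj_mul Hatomic)[].
Qed.

End LengthsOfWords.

Theorem theorem4p10 (I : Type) (H : I -> monoidType) (C : monoidType)
    (inj : forall i : I, H i -> C) (hI : inhabited I)
    (hH : forall i : I, atomic (H i)) (hC : is_atomon_coproduct inj) :
  system_of_lengths_pos C =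
  \bigcup_(w in Gamma H)
    [set sumset L | L in [set L : 'I_(size w) -> set nat |
      forall j, system_of_lengths_pos (H (tnth (in_tuple w) j)) (L j)]].
Proof.
rewrite (coproduct_system_of_lengths hH hC) (free_system_of_lengths hH).
by apply: eq_bigcupr => w _; apply: word_sumsE.
Qed.
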